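(* Let $\mathcal{P}=(P,\preceq)$ be a finite poset with incidence algebra $\mathcal{I}(\mathcal{P})$, and consider a poset-causal system with state-space data $(A,B,C,D,F)$ and associated transfer matrices $P_{11}(s)=C(sI-A)^{-1}F$ and $P_{12}(s)=C(sI-A)^{-1}B+D$. The problem $$\underset{Q}{\text{minimize}}\ \ \|P_{11}+P_{12}Q\|^{2}\quad\text{subject to}\quad Q\in\mathcal{I}(\mathcal{P})$$ is equivalent to the following set of $|P|$ independent decoupled problems: $$\underset{Q^{\downarrow j}}{\text{minimize}}\ \ \|P_{11}(j)+P_{12}(\downarrow j)\,Q^{\downarrow j}\|^{2}\qquad \text{for all } j\in P,$$ where $Q^{\downarrow j}$ is unconstrained. (Equivalent means: $Q\in\mathcal{I}(\mathcal{P})$ is optimal for the first problem if and only if, for every $j\in P$, $Q^{\downarrow j}$ is optimal for the $j$-th problem.)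
   Context: Poset notation. $P=\{1,\dots,p\}$, and $\downarrow j=\{q\in P: j\preceq q\}$. Elements of $P$ are indexed along a linear extension ($i\preceq j$ implies $i\le j$). Block matrices. All matrices are partitioned into blocks indexed by $P$; $M_{ij}$ denotes the $(i,j)$ block. A block matrix $M$ (over any ring, e.g. real numbers or rational functions) is in the (block) incidence algebra $\mathcal{I}(\mathcal{P})$ if $M_{ij}=0$ whenever $j\not\preceq i$. System. $\dot x=Ax+Fw+Bu$, $z=Cx+Du$, in continuous time, with $x=(x_1,\dots,x_p)$, $x_i\in\mathbb{R}^{n_i}$, $u=(u_1,\dots,u_p)$, $u_i\in\mathbb{R}^{m_i}$, $z\in\mathbb{R}^l$; $A=[A_{ij}]$, $B=[B_{ij}]$, $F=[F_{ij}]$ are partitioned into blocks, and $C=[C_j]$, $D=[D_j]$ into block columns. The system is poset-causal if $A,B\in\mathcal{I}(\mathcal{P})$. Standing assumptions: $C^TD=0$, $D^TD\succ0$, $F$ is block diagonal with full column rank, and $(A_{ii},B_{ii})$ is stabilizable for every $i\in P$. Notation. $Q$ ranges over real-rational transfer matrices partitioned compatibly (block rows of sizes $m_i$, block columns compatible with those of $F$). $M(j)$ is the $j$-th block column of $M$; $M(\downarrow j)$ is the submatrix of $M$ consisting of the block columns indexed by $\downarrow j$; $Q^{\downarrow j}=[Q_{ij}]_{i\in\downarrow j}$ is the $j$-th block column of $Q$ shortened to the block rows in $\downarrow j$. $\|\cdot\|$ is the $\mathcal{H}_2$ norm, taken to be $+\infty$ if the transfer matrix is not stable and strictly proper. *)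

(* Defs.v *)
From mathcomp Require Import all_boot all_order all_algebra.
From mathcomp Require Import all_classical all_reals all_analysis.
From mathcomp.real_closed Require Import complex.

Set Implicit Arguments.
Unset Strict Implicit.
Unset Printing Implicit Defensive.

Import Order.TTheory GRing.Theory Num.Theory.
Local Open Scope ring_scope.
Local Open Scope sesquilinear_scope.

Section RationalFunctions.
Variable R : realType.

(* Numerator and denominator in lowest terms; they are determined only up to a
   common nonzero real factor. *)
Definition rf_num (g : {fraction {poly R}}) : {poly R} :=
  let a := (frac (repr g)).1 in let b := (frac (repr g)).2 in a %/ gcdp a b.

Definition rf_den (g : {fraction {poly R}}) : {poly R} :=
  let a := (frac (repr g)).1 in let b := (frac (repr g)).2 in b %/ gcdp a b.

Definition rf_pole (g : {fraction {poly R}}) (z : R[i]) : Prop :=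
  root (map_poly (real_complex R) (rf_den g)) z.

(* Meaningful only where z is not a pole of g. *)
Definition rf_eval (g : {fraction {poly R}}) (z : R[i]) : R[i] :=
  (map_poly (real_complex R) (rf_num g)).[z] /
  (map_poly (real_complex R) (rf_den g)).[z].

Definition rf_stable (g : {fraction {poly R}}) : Prop :=
  forall z : R[i], rf_pole g z -> complex.Re z < 0.

Definition rf_strictly_proper (g : {fraction {poly R}}) : Prop :=
  (size (rf_num g) < size (rf_den g))%N.

Definition rf_const (x : R) : {fraction {poly R}} := tofrac x%:P.

End RationalFunctions.

Section H2Norm.
Variable R : realType.

Definition freq_response (m n : nat) (G : 'M[{fraction {poly R}}]_(m, n))
    (w : R) : 'M[R[i]]_(m, n) :=
  map_mx (fun g => rf_eval g (Complex 0 w)) G.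

Definition in_H2 (m n : nat) (G : 'M[{fraction {poly R}}]_(m, n)) : Prop :=
  forall i j, rf_stable (G i j) /\ rf_strictly_proper (G i j).

Definition h2norm (m n : nat) (G : 'M[{fraction {poly R}}]_(m, n)) : \bar R :=
  if `[< in_H2 G >] then
    sqrte (((2 * pi)^-1)%:E *
      \int[lebesgue_measure]_(w in [set: R])
        (complex.Re (\tr ((freq_response G w)^t* *m freq_response G w)))%:E)%E
  else +oo%E.

End H2Norm.

Section StateSpace.
Variable R : realType.

Definition transfer_strict (n m l : nat) (A : 'M[R]_n) (B : 'M[R]_(n, m))
    (C : 'M[R]_(l, n)) : 'M[{fraction {poly R}}]_(l, m) :=
  map_mx (@rf_const R) C
    *m invmx ((tofrac ('X : {poly R}))%:M - map_mx (@rf_const R) A)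
    *m map_mx (@rf_const R) B.

Definition transfer (n m l : nat) (A : 'M[R]_n) (B : 'M[R]_(n, m))
    (C : 'M[R]_(l, n)) (D : 'M[R]_(l, m)) : 'M[{fraction {poly R}}]_(l, m) :=
  transfer_strict A B C + map_mx (@rf_const R) D.

Definition hurwitz (n : nat) (A : 'M[R]_n) : Prop :=
  forall z : R[i], eigenvalue (map_mx (real_complex R) A) z -> complex.Re z < 0.

Definition stabilizable (n m : nat) (A : 'M[R]_n) (B : 'M[R]_(n, m)) : Prop :=
  exists K : 'M[R]_(m, n), hurwitz (A + B *m K).

Definition posdefmx (n : nat) (M : 'M[R]_n) : Prop :=
  M^T = M /\ forall v : 'cV[R]_n, v != 0 -> 0 < (v^T *m M *m v) 0 0.

End StateSpace.

Section PosetBlocks.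
Variables (p : nat) (prec : rel 'I_p).

Definition incidence_alg (K : nmodType) (r c : 'I_p -> nat)
    (M : 'M[K]_(\sum_i r i, \sum_i c i)) : Prop :=
  forall i j : 'I_p, ~~ prec j i -> submxblock M i j = 0.

Definition block_diagonal (K : nmodType) (r c : 'I_p -> nat)
    (M : 'M[K]_(\sum_i r i, \sum_i c i)) : Prop :=
  forall i j : 'I_p, i != j -> submxblock M i j = 0.

(* The set of all q with j <= q, which the literature on poset-causal systems
   writes with a downward arrow. *)
Definition downset (j : 'I_p) : {set 'I_p} := [set q | prec j q].

Definition down_size (r : 'I_p -> nat) (j : 'I_p) : nat :=
  \sum_(t < #|downset j|) r (enum_val t).

Definition down_cols (K : Type) (l : nat) (c : 'I_p -> nat)
    (M : 'M[K]_(l, \sum_i c i)) (j : 'I_p) : 'M[K]_(l, down_size c j) :=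
  \mxrow_(t < #|downset j|) submxrow M (enum_val t).

Definition down_col (K : Type) (r c : 'I_p -> nat)
    (M : 'M[K]_(\sum_i r i, \sum_i c i)) (j : 'I_p) :
    'M[K]_(down_size r j, c j) :=
  \mxcol_(t < #|downset j|) submxblock M (enum_val t) j.

End PosetBlocks.

Definition optimal (R : realType) (T : Type) (feasible : T -> Prop)
    (cost : T -> \bar R) (x : T) : Prop :=
  feasible x /\ forall y, feasible y -> (cost x <= cost y)%E.

(* Main.v *)
Require Import Defs.
From mathcomp Require Import all_boot all_order all_algebra.
From mathcomp Require Import all_classical all_reals all_analysis.
From mathcomp.real_closed Require Import complex.
From mathcomp Require Import measurable_realfun ring zify.

Set Implicit Arguments.
Unset Strict Implicit.
Unset Printing Implicit Defensive.

Import Order.TTheory GRing.Theory Num.Theory.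
Import numFieldNormedType.Exports.
Local Open Scope ring_scope.

(** The squared H2 norm of a matrix is the sum of the energies of its entries,
    so it is also the sum of the squared norms of its block columns
    ([h2norm_sqr_cols]); this holds in the extended reals as well, one side
    being infinite exactly when the other is.  For Q in the incidence algebra,
    the j-th block column of P11 + P12 Q only involves the blocks of Q in
    column j and in the rows above j in the poset, that is, [down_col Q j]
    ([mul_submxrow_incidence]), and these shortened columns can be chosen
    freely and independently ([assemble_incidence], [down_col_assemble]).  The
    first problem therefore minimizes a sum of nonnegative costs over a product
    of unconstrained sets.

    Minimizing such a sum amounts to minimizing every summand as soon as some
    point has a finite total cost ([optimal_separable]).  Without such a point
    the equivalence could fail: every Q would be optimal for the sum, with cost
    +oo, even when some column could still be improved.  This is where
    stabilizability is needed.  Local gains K_i making A_ii + B_ii K_i Hurwitz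
    form a block diagonal K; the matrix A + B K is block triangular along the
    linear extension, hence Hurwitz ([hurwitz_incidence]).  The parameter
    Q = K (sI - A - B K)^-1 F lies in the incidence algebra, because inverses of
    incidence matrices are incidence matrices ([incidence_invmx]), and it turns
    P11 + P12 Q into the closed loop (C + D K) (sI - A - B K)^-1 F
    ([state_feedback_loop]), which is stable and strictly proper.

    Finally a stable strictly proper rational function has finite energy: on
    the imaginary axis its squared modulus is continuous and bounded by a
    multiple of 1 / (1 + w^2) ([gain_decay]), as one sees by factoring the
    numerator and the denominator into complex linear factors. *)

(** * Reduced fractions *)

Section ReducedFractions.
Variable R : realType.
Implicit Types (g : {fraction {poly R}}) (a b : {poly R}).

Lemma rf_den_neq0 g : rf_den g != 0.
Proof.
rewrite /rf_den; set a := (frac _).1; set b := (frac _).2.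
have b0 : b != 0 by exact: denom_ratioP.
by rewrite divp_eq0 (negPf b0) !negb_or /= gcdp_eq0 (negPf b0) andbF /= -leqNgt leq_gcdpr.
Qed.

Lemma coprime_rf g : coprimep (rf_num g) (rf_den g).
Proof.
rewrite /rf_den /rf_num; set a := (frac _).1; set b := (frac _).2.
have b0 : b != 0 by exact: denom_ratioP.
by apply: coprimep_div_gcd; rewrite b0 orbT.
Qed.

(** The representative chosen by the quotient is unknown; cross-multiplication is
    what relates it to a given presentation of [g] as a quotient. *)
Lemma rf_cross g a b : b != 0 -> g * tofrac b = tofrac a ->
  rf_num g * b = rf_den g * a.
Proof.
move=> b0 gab.
rewrite /rf_num /rf_den; set c := (frac _).1; set d := (frac _).2.
have d0 : d != 0 by exact: denom_ratioP.
have gE : g * tofrac d = tofrac c.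
  rewrite -[g in LHS]reprK /c /d; move: (repr g) => x; unlock FracField.tofrac.
  rewrite -[LHS]FracField.pi_mul; apply/eqmodP.
  rewrite /= FracField.equivfE /FracField.mulf.
  by rewrite !numden_Ratio ?mulf_neq0 ?oner_neq0 ?denom_ratioP// !mulr1 mulrC.
set h := gcdp c d.
have h0 : h != 0 by rewrite gcdp_eq0 negb_and d0 orbT.
have cb : c * b = d * a.
  apply/eqP; rewrite -tofrac_eq !tofracM -gE -gab; apply/eqP; ring.
apply: (mulIf h0).
rewrite mulrAC divpK ?dvdp_gcdl// cb mulrAC divpK ?dvdp_gcdr//.
Qed.

(** This bounds the poles of [g] without computing its reduced form. *)
Lemma rf_den_dvd g a b : b != 0 -> g * tofrac b = tofrac a -> rf_den g %| b.
Proof.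
move=> b0 /(rf_cross b0) e.
by rewrite -(@Gauss_dvdpr _ _ (rf_num g)) ?e ?dvdp_mulIl// coprimep_sym coprime_rf.
Qed.

Lemma rf_strictly_proper_ratio g (a b : {poly R}) : (size a < size b)%N ->
  g * tofrac b = tofrac a -> rf_strictly_proper g.
Proof.
move=> ab gab; rewrite /rf_strictly_proper.
have b0 : b != 0 by rewrite -size_poly_eq0 -lt0n (leq_trans _ ab).
have e := rf_cross b0 gab.
have [n0|n0] := eqVneq (rf_num g) 0.
  by rewrite n0 size_poly0 lt0n size_poly_eq0 rf_den_neq0.
have a0 : a != 0 by rewrite -(mulrI_eq0 _ (mulfI (rf_den_neq0 g))) -e mulf_neq0.
move/(congr1 (fun p : {poly R} => size p)): e.
rewrite !size_mul ?rf_den_neq0// => /eqP.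
have := size_poly_gt0 a; have := size_poly_gt0 (rf_num g).
rewrite a0 n0; move: ab; move: (size a) (size b) (size (rf_num g)) (size (rf_den g)).
move=> x y z t; lia.
Qed.
End ReducedFractions.

(** * Polynomials on the imaginary axis *)

Section ImaginaryAxis.
Variable R : realType.
Implicit Types (p : {poly R[i]}) (z : R[i]) (w : R).

Definition sqmod z : R := complex.Re z ^+ 2 + complex.Im z ^+ 2.

Lemma sqmod_ge0 z : 0 <= sqmod z.
Proof. by rewrite addr_ge0 ?sqr_ge0. Qed.

Lemma sqmodE z : sqmod z = complex.Re (`|z| ^+ 2).
Proof. by rewrite -add_Re2_Im2. Qed.

Lemma sqmodM z1 z2 : sqmod (z1 * z2) = sqmod z1 * sqmod z2.
Proof. by case: z1 z2 => [a b] [c d]; rewrite /sqmod /=; ring. Qed.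

Lemma sqmod1 : sqmod 1 = 1.
Proof. by rewrite /sqmod /= expr1n expr0n addr0. Qed.

Lemma sqmod_eq0 z : (sqmod z == 0) = (z == 0).
Proof.
by rewrite paddr_eq0 ?sqr_ge0// !sqrf_eq0 eq_complex.
Qed.

Lemma sqmodV z : sqmod z^-1 = (sqmod z)^-1.
Proof.
have [->|z0] := eqVneq z 0.
  by rewrite !invr0 /sqmod /= expr0n addr0 invr0.
apply: (mulfI (_ : sqmod z != 0)); first by rewrite sqmod_eq0.
by rewrite -sqmodM !divff ?sqmod_eq0// sqmod1.
Qed.

Lemma sqmod_linear z w :
  sqmod (Complex 0 w - z) = complex.Re z ^+ 2 + (w - complex.Im z) ^+ 2.
Proof. by case: z => a b; rewrite /sqmod /= add0r sqrrN. Qed.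

(** The constant comes from (w - b)^2 <= 2 w^2 + 2 b^2, where b is the imaginary
    part of [z]. *)
Lemma sqmod_linear_le z w : sqmod (Complex 0 w - z) <=
  (2 + 2 * complex.Im z ^+ 2 + complex.Re z ^+ 2) * oneDsqr w.
Proof.
rewrite sqmod_linear /oneDsqr; case: z => a b /=.
rewrite -subr_ge0 (_ : _ - _ =
    (w + b) ^+ 2 + 2 + 2 * (b * w) ^+ 2 + (a * w) ^+ 2); last by ring.
by rewrite !(addr_ge0, sqr_ge0, divr_ge0, mulr_ge0, ler0n, ler01).
Qed.

(** Here w^2 <= 2 (w - b)^2 + 2 b^2 gives
    1 + w^2 <= 2 (w - b)^2 + (2 b^2 + 1), and the last constant is a multiple of
    the squared real part of [z], which the factor always dominates. *)
Lemma sqmod_linear_ge z w : complex.Re z != 0 -> oneDsqr w <=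
  (2 + (2 * complex.Im z ^+ 2 + 1) / complex.Re z ^+ 2) * sqmod (Complex 0 w - z).
Proof.
rewrite sqmod_linear /oneDsqr; case: z => a b /= a0.
rewrite -subr_ge0 (_ : _ - _ = (w - 2 * b) ^+ 2 + 2 * a ^+ 2 +
    ((2 * b ^+ 2 + 1) / a ^+ 2) * (w - b) ^+ 2); last by field.
by rewrite !(addr_ge0, sqr_ge0, divr_ge0, mulr_ge0, ler0n, ler01).
Qed.

Lemma prod_const_size (I : Type) (r : seq I) (x : R) :
  \prod_(z <- r) x = x ^+ size r.
Proof. by rewrite big_const_seq count_predT iter_mulr_1. Qed.

(** Over the complex numbers every [p] is split in this way; its squared modulus
    on the axis is then a product of real quadratic polynomials in [w], from
    which regularity and growth can be read off. *)
Lemma sqmod_axis_factor p (r : seq R[i]) w :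
  p = lead_coef p *: \prod_(z <- r) ('X - z%:P) ->
  sqmod p.[Complex 0 w] =
    sqmod (lead_coef p) * \prod_(z <- r) sqmod (Complex 0 w - z).
Proof.
move=> pE; rewrite pE hornerZ sqmodM horner_prod (big_morph _ sqmodM sqmod1) -pE.
by congr (_ * _); apply: eq_bigr => z _; rewrite hornerXsubC.
Qed.

Lemma size_factored p (r : seq R[i]) : p != 0 ->
  p = lead_coef p *: \prod_(z <- r) ('X - z%:P) -> (size p).-1 = size r.
Proof.
by move=> p0 ->; rewrite size_scale ?lead_coef_eq0// size_prod_XsubC.
Qed.

Lemma sqmod_axis_poly p :
  exists q : {poly R}, forall w, sqmod p.[Complex 0 w] = q.[w].
Proof.
have [r pE] := closed_field_poly_normal p.
exists ((sqmod (lead_coef p))%:P * \prod_(z <- r)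
    ((complex.Re z ^+ 2)%:P + ('X - (complex.Im z)%:P) ^+ 2)) => w.
rewrite (sqmod_axis_factor _ pE) hornerM hornerC horner_prod; congr (_ * _).
by apply: eq_bigr => z _; rewrite sqmod_linear !hornerE.
Qed.

Lemma sqmod_axis_le p : p != 0 -> exists2 c, 0 <= c &
  forall w, sqmod p.[Complex 0 w] <= c * oneDsqr w ^+ (size p).-1.
Proof.
move=> p0; have [r pE] := closed_field_poly_normal p.
exists (sqmod (lead_coef p) *
    \prod_(z <- r) (2 + 2 * complex.Im z ^+ 2 + complex.Re z ^+ 2)).
  rewrite mulr_ge0 ?sqmod_ge0// prodr_ge0// => z _.
  by rewrite !(addr_ge0, sqr_ge0, mulr_ge0, ler0n).
move=> w; rewrite (sqmod_axis_factor _ pE) -mulrA ler_wpM2l ?sqmod_ge0//.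
rewrite (size_factored p0 pE) -prod_const_size -big_split/=.
by apply: ler_prod => z _; rewrite sqmod_ge0 sqmod_linear_le.
Qed.

Lemma sqmod_axis_ge p : p != 0 -> (forall w, p.[Complex 0 w] != 0) ->
  exists2 c, 0 <= c &
    forall w, oneDsqr w ^+ (size p).-1 <= c * sqmod p.[Complex 0 w].
Proof.
move=> p0 nz; have [r pE] := closed_field_poly_normal p.
have lc0 : sqmod (lead_coef p) != 0 by rewrite sqmod_eq0 lead_coef_eq0.
have rnz z : z \in r -> complex.Re z != 0.
  case: z => a b zr; apply/eqP => /= a0; move: (nz b).
  rewrite pE hornerZ horner_prod (big_rem _ zr)/= hornerXsubC a0 subrr.
  by rewrite mul0r mulr0 eqxx.
exists ((sqmod (lead_coef p))^-1 *
    \prod_(z <- r) (2 + (2 * complex.Im z ^+ 2 + 1) / complex.Re z ^+ 2)).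
  rewrite mulr_ge0 ?invr_ge0 ?sqmod_ge0// prodr_ge0// => z _.
  by rewrite !(addr_ge0, sqr_ge0, divr_ge0, mulr_ge0, ler0n, ler01).
move=> w; rewrite (sqmod_axis_factor _ pE) mulrACA mulVf// mul1r.
rewrite (size_factored p0 pE) -prod_const_size -big_split/=.
rewrite big_seq [leRHS]big_seq; apply: ler_prod => z zr.
by rewrite (le_trans ler01) ?oneDsqr_ge1// sqmod_linear_ge ?rnz.
Qed.
End ImaginaryAxis.

(** * The squared H2 norm *)

Section EnergyAndH2Norm.
Local Open Scope sesquilinear_scope.
Variable R : realType.
Implicit Types (g : {fraction {poly R}}).
Local Notation mu := (@lebesgue_measure R).

Definition gain g (w : R) : R := sqmod (rf_eval g (Complex 0 w)).

Definition admissible g : Prop := rf_stable g /\ rf_strictly_proper g.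

Definition energy g : \bar R :=
  (((2 * pi)^-1)%:E * \int[mu]_(w in [set: R]) (gain g w)%:E)%E.

Lemma gain_ge0 g w : 0 <= gain g w.
Proof. exact: sqmod_ge0. Qed.

Lemma gainE g w : gain g w =
  sqmod (map_poly (real_complex R) (rf_num g)).[Complex 0 w] /
  sqmod (map_poly (real_complex R) (rf_den g)).[Complex 0 w].
Proof. by rewrite /gain /rf_eval sqmodM sqmodV. Qed.

Lemma den_axis_neq0 g w : rf_stable g ->
  (map_poly (real_complex R) (rf_den g)).[Complex 0 w] != 0.
Proof. by move=> st; apply/negP => /st /=; rewrite ltxx. Qed.

Lemma continuous_gain g : rf_stable g -> continuous (gain g).
Proof.
move=> st.
have [a aE] := sqmod_axis_poly (map_poly (real_complex R) (rf_num g)).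
have [b bE] := sqmod_axis_poly (map_poly (real_complex R) (rf_den g)).
have -> : gain g = (fun w => a.[w] / b.[w]).
  by apply/funext => w; rewrite gainE aE bE.
move=> w; apply: cvgM; first exact: continuous_horner.
apply: cvgV; last exact: continuous_horner.
by rewrite -bE sqmod_eq0 den_axis_neq0.
Qed.

(** Strict properness leaves a gap of at least one power of 1 + w^2 between the
    upper bound on the numerator and the lower bound on the denominator. *)
Lemma gain_decay g : admissible g -> exists2 c, 0 <= c &
  forall w, gain g w <= c * (oneDsqr w)^-1.
Proof.
move=> [st sp].
have [n0|n0] := eqVneq (rf_num g) 0.
  exists 0 => // w; rewrite gainE n0 rmorph0 horner0 mul0r.
  by rewrite /sqmod /= !expr0n addr0 mul0r.
have [|c c0 cE] := @sqmod_axis_le _ (map_poly (real_complex R) (rf_num g)).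
  by rewrite map_poly_eq0.
have [||d d0 dE] := @sqmod_axis_ge _ (map_poly (real_complex R) (rf_den g)).
- by rewrite map_poly_eq0 rf_den_neq0.
- by move=> w; exact: den_axis_neq0.
exists (c * d); first exact: mulr_ge0.
move=> w; rewrite gainE.
have D1 : 1 <= oneDsqr w by exact: oneDsqr_ge1.
have D0 : 0 < oneDsqr w by exact: lt_le_trans D1.
have q0 : 0 < sqmod (map_poly (real_complex R) (rf_den g)).[Complex 0 w].
  by rewrite lt_def sqmod_ge0 sqmod_eq0 den_axis_neq0.
rewrite ler_pdivrMr// mulrAC ler_pdivlMr//.
(* The spare factor 1 + w^2 is absorbed by the degree gap. *)
apply: (@le_trans _ _ (c * oneDsqr w ^+ (size (rf_num g)))).
  have -> : size (rf_num g) = (size (rf_num g)).-1.+1.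
    by rewrite prednK// size_poly_gt0.
  rewrite exprSr mulrA ler_wpM2r ?(ltW D0)//.
  by have := cE w; rewrite size_map_poly.
rewrite -mulrA ler_wpM2l//; apply: le_trans (dE w).
rewrite size_map_poly ler_weXn2l//.
by move: sp; rewrite /rf_strictly_proper; case: (size (rf_den g)).
Qed.

Lemma integralT_oneDsqrV : (\int[mu]_x (oneDsqr x)^-1%:E = pi%:E)%E.
Proof.
rewrite ge0_symfun_integralT//=.
- rewrite (_ : [set x | _] = `[0, +oo[)%classic; last first.
    by apply/seteqP; split => x/=; rewrite in_itv/= andbT.
  by rewrite integral0y_oneDsqr -EFinM mulrCA divff// mulr1.
- exact: continuous_oneDsqrV.
- by move=> x/=; rewrite /oneDsqr sqrrN.
Qed.

Lemma measurable_gain g : rf_stable g -> measurable_fun [set: R] (gain g).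
Proof.
by move=> st; apply: continuous_measurable_fun; exact: continuous_gain.
Qed.

Lemma energy_ge0 g : (0 <= energy g)%E.
Proof.
rewrite mule_ge0 ?lee_fin ?invr_ge0 ?mulr_ge0 ?pi_ge0//.
by apply: integral_ge0 => w _; rewrite lee_fin gain_ge0.
Qed.

Lemma energy_fin g : admissible g -> energy g \is a fin_num.
Proof.
move=> ag; have [st _] := ag; have [c c0 cE] := gain_decay ag.
rewrite fin_numM// ge0_fin_numE; last first.
  by apply: integral_ge0 => w _; rewrite lee_fin gain_ge0.
apply: (@le_lt_trans _ _ (\int[mu]_(w in [set: R]) (c%:E * (oneDsqr w)^-1%:E))%E).
  apply: ge0_le_integral => //.
  - by move=> w _; rewrite lee_fin gain_ge0.
  - apply/measurable_EFinP; exact: measurable_gain.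
  - apply/measurable_EFinP; apply: measurable_funM; first exact: measurable_cst.
    by apply: continuous_measurable_fun; exact: continuous_oneDsqrV.
  - by move=> w _; rewrite -EFinM lee_fin.
rewrite ge0_integralZl//.
  by rewrite integralT_oneDsqrV -EFinM ltry.
by apply/measurable_EFinP; apply: continuous_measurable_fun; exact: continuous_oneDsqrV.
Qed.

Lemma Re_sum (I : Type) (r : seq I) (F : I -> R[i]) :
  complex.Re (\sum_(i <- r) F i) = \sum_(i <- r) complex.Re (F i).
Proof. by apply: (big_morph (@complex.Re R)) => // -[? ?] [? ?]. Qed.

(** The integral commutes with the finite sum over the entries because the
    gains are nonnegative and, by stability, continuous. *)
Lemma h2norm_sqr (m n : nat) (G : 'M[{fraction {poly R}}]_(m, n)) : in_H2 G ->
  (h2norm G ^+ 2 = \sum_j \sum_i energy (G i j))%E.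
Proof.
move=> hG; rewrite /h2norm; case: asboolP => // _.
have tr w : complex.Re (\tr ((freq_response G w)^t* *m freq_response G w)) =
    \sum_j \sum_i gain (G i j) w.
  rewrite /mxtrace Re_sum; apply: eq_bigr => j _.
  rewrite mxE Re_sum; apply: eq_bigr => i _.
  by rewrite /gain sqmodE normCKC !mxE.
under eq_integral do rewrite tr -sumEFin.
rewrite sqr_sqrte; last first.
  rewrite mule_ge0 ?lee_fin ?invr_ge0 ?mulr_ge0 ?pi_ge0//.
  apply: integral_ge0 => w _; rewrite sumEFin lee_fin sumr_ge0// => j _.
  by rewrite sumr_ge0// => i _; exact: gain_ge0.
under eq_integral do under eq_bigr do rewrite -sumEFin.
rewrite ge0_integral_sum//=; first last.
- by move=> j w _; rewrite sume_ge0// => i _; rewrite lee_fin gain_ge0.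
- move=> j; apply: emeasurable_sum => i; apply/measurable_EFinP.
  by apply: measurable_gain; case: (hG i j).
rewrite ge0_sume_distrr; last first.
  move=> j _; apply: integral_ge0 => w _; rewrite sume_ge0// => i _.
  by rewrite lee_fin gain_ge0.
apply: eq_bigr => j _; rewrite ge0_integral_sum//=; first last.
- by move=> i w _; rewrite lee_fin gain_ge0.
- by move=> i; apply/measurable_EFinP; apply: measurable_gain; case: (hG i j).
rewrite ge0_sume_distrr// => i _.
by apply: integral_ge0 => w _; rewrite lee_fin gain_ge0.
Qed.

Lemma h2norm_sqr_notin (m n : nat) (G : 'M[{fraction {poly R}}]_(m, n)) :
  ~ in_H2 G -> (h2norm G ^+ 2 = +oo)%E.
Proof. by move=> hG; rewrite /h2norm; case: asboolP => // _; rewrite expe2 mulyy. Qed.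

Lemma h2norm_sqr_ge0 (m n : nat) (G : 'M[{fraction {poly R}}]_(m, n)) :
  (0 <= h2norm G ^+ 2)%E.
Proof.
have [hG|hG] := pselect (in_H2 G); last by rewrite h2norm_sqr_notin.
by rewrite h2norm_sqr// sume_ge0// => j _; rewrite sume_ge0// => i _; exact: energy_ge0.
Qed.

Lemma h2norm_sqr_fin (m n : nat) (G : 'M[{fraction {poly R}}]_(m, n)) :
  in_H2 G -> (h2norm G ^+ 2)%E \is a fin_num.
Proof.
move=> hG; rewrite h2norm_sqr// sum_fin_num; apply/allP => _ /mapP[j _ ->].
rewrite /= sum_fin_num; apply/allP => _ /mapP[i _ ->] /=; exact/energy_fin/hG.
Qed.

(** The identity survives infinite norms: an entry outside H2 makes both the
    whole matrix and its block column infinite. *)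
Lemma h2norm_sqr_cols (l p : nat) (k : 'I_p -> nat)
    (G : 'M[{fraction {poly R}}]_(l, \sum_i k i)) :
  (h2norm G ^+ 2 = \sum_j h2norm (submxrow G j) ^+ 2)%E.
Proof.
have [hG|hG] := pselect (in_H2 G).
  have hGj j : in_H2 (submxrow G j) by move=> i t; rewrite mxE; exact: hG.
  rewrite h2norm_sqr//; under [RHS]eq_bigr do rewrite h2norm_sqr//.
  rewrite [RHS]sig_big_dep [RHS](reindex _ tagnat.sig_bij_on)/=.
  apply: eq_bigr => t _; apply: eq_bigr => i _.
  by rewrite !mxE tagnat.sig2K.
rewrite h2norm_sqr_notin//; apply/esym/eqP; rewrite esum_eqy; last first.
  by move=> j _; rewrite gt_eqF// (lt_le_trans _ (h2norm_sqr_ge0 _))// ltNy0.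
apply/existsP/not_existsP => hGj; apply: hG => i t.
have : in_H2 (submxrow G (tagnat.sig1 t)).
  by apply: contrapT => nH; apply: (hGj (tagnat.sig1 t)); rewrite h2norm_sqr_notin/=.
by move=> /(_ i (tagnat.sig2 t)); rewrite mxE tagnat.sig2K.
Qed.
End EnergyAndH2Norm.

(** * Minimization of a separable cost *)

Section Separable.
Variables (R : realType) (I : finType) (T : I -> Type) (c : forall i, T i -> \bar R).
Implicit Types i : I.
Hypothesis c_ge0 : forall i (x : T i), (0 <= c x)%E.

(** Replacing one coordinate of a minimizer of the sum changes one summand; the
    others can be cancelled because they are finite, and they are finite
    because the minimizer does at least as well as [y0]. *)
Lemma optimal_separable (y0 : forall i, T i) (y : forall i, T i) :
  (\sum_i c (y0 i) \is a fin_num)%E ->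
  (forall y' : forall i, T i, (\sum_i c (y i) <= \sum_i c (y' i))%E) <->
  (forall i, optimal (fun=> True) (@c i) (y i)).
Proof.
move=> fin0; split => [opt i|opt y']; last first.
  by apply: lee_sum => i _; case: (opt i) => _; exact.
split=> // x _.
have := opt (eqtype.dfwith y x).
rewrite (bigD1 i)//= [leRHS](bigD1 i)//= dfwith_in.
under [in leRHS]eq_bigr => j ji do rewrite dfwith_out 1?eq_sym//.
have rest_ge0 : (0 <= \sum_(j | j != i) c (y j))%E by exact: sume_ge0.
rewrite leeD2rE// ge0_fin_numE//.
apply: le_lt_trans (_ : (\sum_j c (y0 j) < +oo)%E).
  by apply: le_trans (opt y0); rewrite [leRHS](bigD1 i)//= leeDr.
by rewrite ltey_eq fin0.
Qed.
(** When the cost of a feasible point is the sum of the costs of its components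
    and the components can be prescribed freely, the previous lemma applies to
    the components. *)
Lemma optimal_decoupled (X : Type) (feasible : X -> Prop) (J : X -> \bar R)
    (components : X -> forall i, T i) (glue : (forall i, T i) -> X) (x0 x : X) :
  (forall y, feasible (glue y)) -> (forall y i, components (glue y) i = y i) ->
  (forall z, feasible z -> J z = (\sum_i c (components z i))%E) ->
  feasible x0 -> J x0 \is a fin_num -> feasible x ->
  optimal feasible J x <->
  forall i, optimal (fun=> True) (@c i) (components x i).
Proof.
move=> glueF glueK JE fx0 fin0 fx; rewrite -(@optimal_separable (components x0)).
  split=> [[_ opt] y|opt].
    rewrite -JE// (le_trans (opt _ (glueF y)))// JE//.
    by under eq_bigr do rewrite glueK.
  by split=> // z fz; rewrite !JE.
by rewrite -JE.
Qed.
End Separable.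

(** * Shortened block columns *)

Section DownSets.
Variables (K : pzRingType) (p : nat) (prec : rel 'I_p).

(** The position, among all rows, of a row of a shortened column.  All the
    blockwise selections below are plain row or column selections along this
    injection, which avoids casts between the sizes of equal blocks. *)
Definition down_index (r : 'I_p -> nat) (j : 'I_p) (s : 'I_(down_size prec r j)) :
  'I_(\sum_i r i) :=
  tagnat.Rank (enum_val (tagnat.sig1 s)) (tagnat.sig2 s).

Lemma down_index_inj r j : injective (@down_index r j).
Proof.
move=> s t /eqP; rewrite -val_eqE /= tagnat.eq_Rank => /andP[/eqP/enum_val_inj e1 e2].
apply/eqP; rewrite -(tagnat.sig2K s) -(tagnat.sig2K t) -val_eqE/= tagnat.eq_Rank.
by apply/andP; split; first exact/eqP.
Qed.

Lemma down_index_in r j (s : 'I_(down_size prec r j)) :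
  prec j (tagnat.sig1 (down_index s)).
Proof.
by rewrite tagnat.Rank1K; have := enum_valP (tagnat.sig1 s); rewrite inE.
Qed.

Lemma down_index_surj r j (x : 'I_(\sum_i r i)) : prec j (tagnat.sig1 x) ->
  exists s, x = @down_index r j s.
Proof.
move=> jx; have xd : tagnat.sig1 x \in downset prec j by rewrite inE.
have xE : enum_val (enum_rank_in xd (tagnat.sig1 x)) = tagnat.sig1 x.
  by rewrite enum_rankK_in.
exists (@tagnat.Rank _ (fun t => r (enum_val t)) (enum_rank_in xd (tagnat.sig1 x))
  (cast_ord (congr1 r (esym xE)) (tagnat.sig2 x))).
apply/eqP; rewrite -{1}(tagnat.sig2K x) -val_eqE /= tagnat.eq_Rank.
apply/andP; split; first by rewrite tagnat.Rank1K xE.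
by rewrite tagnat.Rank2K.
Qed.

Lemma down_colsE (l : nat) r (M : 'M[K]_(l, \sum_i r i)) j :
  down_cols prec M j = colsub (@down_index r j) M.
Proof. by apply/matrixP => a b; rewrite !mxE. Qed.

Lemma down_colE r c (M : 'M[K]_(\sum_i r i, \sum_i c i)) j :
  down_col prec M j = rowsub (@down_index r j) (submxrow M j).
Proof. by apply/matrixP => a b; rewrite !mxE. Qed.

(** The left factor is the 0-1 matrix of the injection [down_index], so this
    extends [Y] by zero to all rows. *)
Definition pad_rows r n j (Y : 'M[K]_(down_size prec r j, n)) :
  'M[K]_(\sum_i r i, n) :=
  colsub (@down_index r j) 1%:M *m Y.

Lemma rowsub_pad r n j (Y : 'M[K]_(down_size prec r j, n)) :
  rowsub (@down_index r j) (pad_rows Y) = Y.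
Proof.
rewrite /pad_rows -mul_rowsub_mx -[RHS]mul1mx; congr (_ *m _).
by apply/matrixP => a b; rewrite !mxE (inj_eq (@down_index_inj _ _)).
Qed.

Lemma pad_rows_out r n j (Y : 'M[K]_(down_size prec r j, n)) i :
  ~~ prec j i -> submxcol (pad_rows Y) i = 0.
Proof.
move=> nji; apply/matrixP => a b; rewrite !mxE [LHS]big1// => s _.
rewrite !mxE; case: eqP => [e|_]; last by rewrite mul0r.
by move: nji; rewrite -(tagnat.Rank1K a) e down_index_in.
Qed.

Lemma pad_rowsub r n j (X : 'M[K]_(\sum_i r i, n)) :
  (forall i, ~~ prec j i -> submxcol X i = 0) ->
  pad_rows (rowsub (@down_index r j) X) = X.
Proof.
move=> X0; apply/matrixP => x b; rewrite !mxE.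
have [jx|njx] := boolP (prec j (tagnat.sig1 x)).
  have [s ->] := down_index_surj jx.
  rewrite (bigD1 s)//= !mxE eqxx mul1r.
  rewrite [X in _ + X = _]big1 ?addr0// => t ts.
  by rewrite !mxE (inj_eq (@down_index_inj _ _)) eq_sym (negPf ts) mul0r.
rewrite [LHS]big1 => [|t _].
  by move/matrixP/(_ (tagnat.sig2 x) b): (X0 _ njx); rewrite !mxE tagnat.sig2K.
rewrite !mxE; case: eqP => [e|_]; last by rewrite mul0r.
by move: njx; rewrite e down_index_in.
Qed.

Lemma mul_pad l r n j (M : 'M[K]_(l, \sum_i r i)) (Y : 'M[K]_(down_size prec r j, n)) :
  M *m pad_rows Y = down_cols prec M j *m Y.
Proof. by rewrite /pad_rows mulmxA mulmx_colsub mulmx1 down_colsE. Qed.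

Definition assemble r c (Y : forall j, 'M[K]_(down_size prec r j, c j)) :
  'M[K]_(\sum_i r i, \sum_i c i) := \mxrow_j pad_rows (Y j).

Lemma assemble_incidence r c Y : incidence_alg prec (@assemble r c Y).
Proof. by move=> i j nji; rewrite submxblockEh mxrowK pad_rows_out. Qed.

Lemma down_col_assemble r c Y j : down_col prec (@assemble r c Y) j = Y j.
Proof. by rewrite down_colE mxrowK rowsub_pad. Qed.

(** The rows of column j lying outside the down set of j vanish, so padding the
    shortened column restores the whole one. *)
Lemma mul_submxrow_incidence l r c (M : 'M[K]_(l, \sum_i r i))
    (Q : 'M[K]_(\sum_i r i, \sum_i c i)) j : incidence_alg prec Q ->
  submxrow (M *m Q) j = down_cols prec M j *m down_col prec Q j.
Proof.
move=> iQ; rewrite -mul_submxrow down_colE -mul_pad pad_rowsub// => i nji.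
by rewrite -submxblockEh iQ.
Qed.
End DownSets.

(** * The incidence algebra *)

Section BlockTriangular.
Variables (p : nat) (prec : rel 'I_p).
Hypothesis prec_refl : reflexive prec.
Hypothesis prec_trans : transitive prec.
Hypothesis prec_linext : forall i j : 'I_p, prec i j -> (i <= j)%N.

Lemma submxblock_mul (K : pzSemiRingType) (r s t : 'I_p -> nat)
    (M : 'M[K]_(\sum_i r i, \sum_i s i)) (N : 'M[K]_(\sum_i s i, \sum_i t i)) i j :
  submxblock (M *m N) i j = \sum_q submxblock M i q *m submxblock N q j.
Proof.
rewrite submxblockEh -mul_submxrow -submxcol_mul.
rewrite -(submxrowK (submxcol M i)) -(submxcolK (submxrow N j)) mul_mxrow_mxcol.
by apply: eq_bigr => q _; rewrite -submxblockEh -submxblockEv.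
Qed.

Lemma incidence_mul (K : pzSemiRingType) (r s t : 'I_p -> nat)
    (M : 'M[K]_(\sum_i r i, \sum_i s i)) (N : 'M[K]_(\sum_i s i, \sum_i t i)) :
  incidence_alg prec M -> incidence_alg prec N -> incidence_alg prec (M *m N).
Proof.
move=> iM iN i j nji; rewrite submxblock_mul [LHS]big1// => q _.
have [qi|nqi] := boolP (prec q i); last by rewrite iM// mul0mx.
by rewrite iN ?mulmx0//; apply: contra nji => jq; exact: prec_trans qi.
Qed.

Lemma incidence_block_diagonal (K : nmodType) (r c : 'I_p -> nat)
    (M : 'M[K]_(\sum_i r i, \sum_i c i)) :
  block_diagonal M -> incidence_alg prec M.
Proof.
move=> dM i j nji; apply: dM; apply: contraNneq nji => ->; exact: prec_refl.
Qed.

(** Forward substitution along the linear extension: in N N^-1 = 1, an off-support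
    block of the inverse is multiplied by the invertible diagonal block, all the
    other terms vanishing by induction. *)
Lemma incidence_invmx (K : fieldType) (r : 'I_p -> nat) (N : 'M[K]_(\sum_i r i)) :
  incidence_alg prec N -> (forall i, submxblock N i i \in unitmx) ->
  N \in unitmx -> incidence_alg prec (invmx N).
Proof.
move=> iN uN u i j; have [b] := ubnP i; elim: b i => // b IH i ib nji.
have : submxblock (N *m invmx N) i j = 0.
  rewrite mulmxV//; apply/matrixP => a c; rewrite !mxE -val_eqE/= tagnat.eq_Rank.
  by rewrite (_ : (i == j) = false)//; apply: contraNF nji => /eqP->.
rewrite submxblock_mul (bigD1 i)//= [X in _ + X = _]big1 ?addr0 => [|q qi].
  move=> /(congr1 (mulmx (invmx (submxblock N i i)))).
  by rewrite mulmxA mulVmx// mul1mx mulmx0.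
have [pqi|npqi] := boolP (prec q i); last by rewrite iN// mul0mx.
rewrite IH ?mulmx0//.
  by rewrite (leq_trans _ (_ : i <= b)%N)// ltn_neqAle qi prec_linext.
by apply: contra nji => jq; exact: prec_trans pqi.
Qed.

(** Let v be a row eigenvector and j the last index where its block is nonzero;
    only the diagonal block contributes to block j of v M, so this block of v is
    an eigenvector of [submxblock M j j] for the same eigenvalue. *)
Lemma hurwitz_incidence (R : realType) (n : 'I_p -> nat) (M : 'M[R]_(\sum_i n i)) :
  incidence_alg prec M -> (forall i, hurwitz (submxblock M i i)) -> hurwitz M.
Proof.
move=> iM hM z /eigenvalueP[v vM v0].
have [j0 vj0] : exists j, submxrow v j != 0.
  apply/existsP; apply: contraNT v0; rewrite negb_exists => /forallP v0.
  rewrite -(submxrowK v) -(mxrow0 (V := R[i]) (q_ := n) 1); apply/eqP/eq_mxrow => j.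
  by apply/eqP; rewrite -[_ == _]negbK.
pose j := [arg max_(j > j0 | submxrow v j != 0%R) (j : nat)]%N.
have [vj jmax] : submxrow v j != 0 /\ forall i, submxrow v i != 0 -> (i <= j)%N.
  by rewrite /j; case: arg_maxnP.
apply: (hM j); apply/eigenvalueP; exists (submxrow v j) => //.
have := congr1 (fun w => submxrow w j) vM.
rewrite /= -mul_submxrow -[X in X *m _](submxrowK v).
rewrite -[X in _ *m X](submxcolK) mul_mxrow_mxcol.
rewrite (bigD1 j)//= [X in _ + X = _]big1 ?addr0.
  rewrite (_ : submxcol _ j = map_mx (real_complex R) (submxblock M j j)).
    by move=> ->; apply/matrixP => a b; rewrite !mxE.
  by apply/matrixP => a b; rewrite !mxE.
move=> i ij; have [vi|vi] := eqVneq (submxrow v i) 0; first by rewrite vi mul0mx.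
rewrite (_ : submxcol _ i = map_mx (real_complex R) (submxblock M i j)); last first.
  by apply/matrixP => a b; rewrite !mxE.
rewrite iM ?map_mx0 ?mulmx0//; apply: contra ij => /prec_linext ji.
by rewrite -val_eqE eqn_leq ji jmax.
Qed.
End BlockTriangular.

(** * Transfer matrices *)

Lemma resolvent_identity (K : comUnitRingType) n (X Y : 'M[K]_n) :
  X \in unitmx -> Y \in unitmx ->
  invmx Y = invmx X + invmx X *m (X - Y) *m invmx Y.
Proof.
move=> uX uY; rewrite mulmxBr mulmxBl mulVmx// mul1mx -[X in _ - X]mulmxA.
by rewrite mulmxV// mulmx1 addrC subrK.
Qed.

Section Resolvent.
Variable R : realType.
Local Notation constmx := (map_mx (@rf_const R)).

(** The matrix s I - M whose inverse occurs in [transfer_strict]. *)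
Definition resolvent_den n (M : 'M[R]_n) : 'M[{fraction {poly R}}]_n :=
  (tofrac ('X : {poly R}))%:M - constmx M.

Lemma constmxE a b (M : 'M[R]_(a, b)) :
  constmx M = map_mx (@FracField.tofrac {poly R}) (map_mx polyC M).
Proof. by apply/matrixP => i j; rewrite !mxE. Qed.

Lemma constmxM a b c (M : 'M[R]_(a, b)) (N : 'M[R]_(b, c)) :
  constmx (M *m N) = constmx M *m constmx N.
Proof. by rewrite !constmxE !map_mxM. Qed.

Lemma constmxD a b (M N : 'M[R]_(a, b)) : constmx (M + N) = constmx M + constmx N.
Proof. by rewrite !constmxE !map_mxD. Qed.

Lemma resolvent_denE n (M : 'M[R]_n) :
  resolvent_den M = map_mx (@FracField.tofrac {poly R}) (char_poly_mx M).
Proof.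
by rewrite /resolvent_den /char_poly_mx map_mxB map_scalar_mx constmxE.
Qed.

Lemma det_resolvent_den n (M : 'M[R]_n) :
  \det (resolvent_den M) = tofrac (char_poly M).
Proof. by rewrite resolvent_denE det_map_mx. Qed.

Lemma resolvent_den_unit n (M : 'M[R]_n) : resolvent_den M \in unitmx.
Proof.
by rewrite unitmxE det_resolvent_den unitfE tofrac_eq0 monic_neq0// char_poly_monic.
Qed.

(** A cofactor is a determinant of size n - 1 with entries of degree at most 1;
    this is why transfer functions without direct term are strictly proper. *)
Lemma size_adj_char_poly_mx n (M : 'M[R]_n) i j :
  (size (\adj (char_poly_mx M) i j) <= n)%N.
Proof.
case: n M i j => [|n] M i j; first by case: i.
rewrite mxE /cofactor -signr_odd; set d := \det _.
suff sd : (size d <= n.+1)%N.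
  by case: (odd _); rewrite ?expr1 ?expr0 ?mulN1r ?mul1r ?size_polyN.
apply: (leq_trans (size_sum _ _ _)); apply/bigmax_leqP => s _.
have -> : forall (b : bool) (q : {poly R}), size ((-1) ^+ b * q) = size q.
  by move=> [] q; rewrite ?expr1 ?expr0 ?mulN1r ?mul1r ?size_polyN.
apply: (leq_trans (size_prod_leq _ _)).
rewrite card_ord leq_subLR addnS ltnS.
apply: (@leq_trans (\sum_(a < n) 2)); last by rewrite sum_nat_const card_ord muln2 addnn.
apply: leq_sum => a _; rewrite !mxE.
case: (_ == _); rewrite ?mulr1n ?mulr0n ?size_XsubC//.
by rewrite sub0r size_polyN (leq_trans (size_polyC_leq1 _)).
Qed.

(** By Cramer's rule the entries are quotients by the characteristic polynomial,
    whose roots are the eigenvalues of [M]. *)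
Lemma in_H2_transfer_strict n a b (M : 'M[R]_n) (F : 'M[R]_(n, a)) (C : 'M[R]_(b, n)) :
  hurwitz M -> in_H2 (transfer_strict M F C).
Proof.
move=> hM i j.
pose q : {poly R} := (map_mx polyC C *m \adj (char_poly_mx M) *m map_mx polyC F) i j.
have c0 : char_poly M != 0 by rewrite monic_neq0// char_poly_monic.
have e : transfer_strict M F C i j * tofrac (char_poly M) = tofrac q.
  rewrite /transfer_strict -/(resolvent_den M) /invmx.
  rewrite resolvent_den_unit det_resolvent_den.
  rewrite -scalemxAr -scalemxAl [X in X * _]mxE mulrC mulrA divff ?tofrac_eq0// mul1r.
  by rewrite resolvent_denE -map_mx_adj !constmxE -!map_mxM mxE.
split; last first.
  apply: rf_strictly_proper_ratio e; rewrite size_char_poly ltnS /q.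
  move: (\adj _) (size_adj_char_poly_mx M) => N sN; rewrite mxE.
  apply: (leq_trans (size_sum _ _ _)); apply/bigmax_leqP => x _.
  rewrite mxE mulr_suml; apply: (leq_trans (size_sum _ _ _)); apply/bigmax_leqP => y _.
  rewrite !mxE mulrC !mul_polyC; apply: (leq_trans (size_scale_leq _ _)).
  exact: (leq_trans (size_scale_leq _ _) (sN _ _)).
have dv := rf_den_dvd c0 e.
move=> z pz; apply: hM; rewrite eigenvalue_root_char -map_char_poly.
by apply: root_dvdp pz; rewrite dvdp_map.
Qed.

(** The open-loop response with Q = K (sI - A - B K)^-1 F is the response under
    the state feedback u = K x; algebraically, this is the resolvent identity. *)
Lemma state_feedback_loop n m k l (A : 'M[R]_n) (B : 'M[R]_(n, m)) (F : 'M[R]_(n, k))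
    (C : 'M[R]_(l, n)) (D : 'M[R]_(l, m)) (K : 'M[R]_(m, n)) :
  transfer_strict A F C + transfer A B C D *m transfer_strict (A + B *m K) F K =
  transfer_strict (A + B *m K) F (C + D *m K).
Proof.
have := resolvent_identity (resolvent_den_unit A) (resolvent_den_unit (A + B *m K)).
rewrite (_ : resolvent_den A - resolvent_den (A + B *m K) =
    constmx B *m constmx K); last first.
  by rewrite /resolvent_den constmxD constmxM opprB addrC subrKA addrC addKr.
rewrite /transfer /transfer_strict -!/(resolvent_den _) constmxD !constmxM.
move: (invmx (resolvent_den A)) (invmx (resolvent_den (A + B *m K))) => U V UV.
by rewrite !mulmxDl [in X in _ = X + _]UV mulmxDr mulmxDl !mulmxA -!addrA.
Qed.
End Resolvent.

Lemma block_diagonal_scalar (K : pzSemiRingType) (p : nat) (r : 'I_p -> nat) (a : K) :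
  @block_diagonal p K r r a%:M.
Proof.
move=> i j ij; apply/matrixP => x y; rewrite !mxE.
by rewrite -val_eqE /= tagnat.eq_Rank (negPf ij).
Qed.

Lemma submxblock_scalar (K : pzSemiRingType) (p : nat) (r : 'I_p -> nat) (a : K) i :
  submxblock (a%:M : 'M[K]_(\sum_i r i)) i i = a%:M.
Proof.
apply/matrixP => x y; rewrite !mxE -val_eqE /= tagnat.eq_Rank eqxx.
by rewrite val_eqE.
Qed.

(** Stabilizing each diagonal block separately by a static gain stabilizes the
    whole system without leaving the incidence algebra; the parameter realizing
    this feedback supplies the point of finite cost. *)
Lemma incidence_stabilizing (R : realType) (p : nat) (prec : rel 'I_p)
  (prec_refl : reflexive prec) (prec_trans : transitive prec)
  (prec_linext : forall i j : 'I_p, prec i j -> (i <= j)%N)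
  (n m k : 'I_p -> nat) (l : nat)
  (A : 'M[R]_(\sum_i n i)) (B : 'M[R]_(\sum_i n i, \sum_i m i))
  (F : 'M[R]_(\sum_i n i, \sum_i k i))
  (C : 'M[R]_(l, \sum_i n i)) (D : 'M[R]_(l, \sum_i m i)) :
  incidence_alg prec A -> incidence_alg prec B -> incidence_alg prec F ->
  (forall i : 'I_p, stabilizable (submxblock A i i) (submxblock B i i)) ->
  exists2 Q : 'M[{fraction {poly R}}]_(\sum_i m i, \sum_i k i),
    incidence_alg prec Q & in_H2 (transfer_strict A F C + transfer A B C D *m Q).
Proof.
move=> iA iB iF stab; pose fb i := projT1 (cid (stab i)).
(* The cast [conform_mx] is the identity on diagonal blocks. *)
pose K : 'M[R]_(\sum_i m i, \sum_i n i) :=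
  \mxblock_(i, j) (if i == j then conform_mx 0 (fb i) else 0).
have iK : incidence_alg prec K.
  apply: incidence_block_diagonal => // i j ij.
  by rewrite mxblockK (negPf ij).
have iAK : incidence_alg prec (A + B *m K).
  move=> i j nji; rewrite submxblockD iA// add0r.
  by rewrite (incidence_mul prec_trans iB iK nji).
have hAK : hurwitz (A + B *m K).
  apply: (hurwitz_incidence prec_linext iAK) => i.
  rewrite submxblockD submxblock_mul (bigD1 i)//= [X in _ + (_ + X)]big1 ?addr0.
    by rewrite mxblockK eqxx conform_mx_id; exact: projT2 (cid (stab i)).
  by move=> q qi; rewrite mxblockK (negPf qi) mulmx0.
exists (transfer_strict (A + B *m K) F K); last first.
  by rewrite state_feedback_loop; exact: in_H2_transfer_strict.
have const_incidence (r c : 'I_p -> nat) (X : 'M[R]_(\sum_i r i, \sum_i c i)) :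
    incidence_alg prec X -> incidence_alg prec (map_mx (@rf_const R) X).
  move=> iX i j /iX X0; apply/matrixP => a b.
  by have /matrixP/(_ a b) := X0; rewrite !mxE => ->; rewrite /rf_const rmorph0.
apply: (incidence_mul prec_trans); last exact: const_incidence.
apply: (incidence_mul prec_trans); first exact: const_incidence.
apply: incidence_invmx => //; last exact: resolvent_den_unit.
  move=> i j nji; rewrite submxblockB (const_incidence _ _ _ iAK)// subr0.
  apply: incidence_block_diagonal nji => //; exact: block_diagonal_scalar.
move=> i; rewrite submxblockB submxblock_scalar.
rewrite (_ : submxblock (map_mx _ _) i i =
  map_mx (@rf_const R) (submxblock (A + B *m K) i i)) ?resolvent_den_unit//.
by apply/matrixP => a b; rewrite !mxE.
Qed.

(** * Decoupling *)

Theorem theorem2 (R : realType) (p : nat) (prec : rel 'I_p)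
  (prec_refl : reflexive prec)
  (prec_anti : antisymmetric prec)
  (prec_trans : transitive prec)
  (prec_linext : forall i j : 'I_p, prec i j -> (i <= j)%N)
  (n m k : 'I_p -> nat) (l : nat)
  (A : 'M[R]_(\sum_i n i))
  (B : 'M[R]_(\sum_i n i, \sum_i m i))
  (F : 'M[R]_(\sum_i n i, \sum_i k i))
  (C : 'M[R]_(l, \sum_i n i))
  (D : 'M[R]_(l, \sum_i m i))
  (A_causal : incidence_alg prec A)
  (B_causal : incidence_alg prec B)
  (CD_orth : C^T *m D = 0)
  (DD_posdef : posdefmx (D^T *m D))
  (F_diag : block_diagonal F)
  (F_rank : \rank F = (\sum_i k i)%N)
  (AB_stab : forall i : 'I_p, stabilizable (submxblock A i i) (submxblock B i i)) :
  let P11 := transfer_strict A F C in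
  let P12 := transfer A B C D in
  forall Q : 'M[{fraction {poly R}}]_(\sum_i m i, \sum_i k i),
    incidence_alg prec Q ->
    (optimal (@incidence_alg p prec _ m k)
       (fun Q => (h2norm (P11 + P12 *m Q) ^+ 2)%E) Q
     <->
     forall j : 'I_p,
       optimal (fun _ : 'M[{fraction {poly R}}]_(down_size prec m j, k j) => True)
         (fun Qj => (h2norm (submxrow P11 j + down_cols prec P12 j *m Qj) ^+ 2)%E)
         (down_col prec Q j)).
Proof.
move=> P11 P12 Q iQ.
have iF : incidence_alg prec F by exact: incidence_block_diagonal.
have [Q0 iQ0 hQ0] := incidence_stabilizing prec_refl prec_trans prec_linext
  C D A_causal B_causal iF AB_stab.
apply: (@optimal_decoupled R _ _
  (fun j Y => h2norm (submxrow P11 j + down_cols prec P12 j *m Y) ^+ 2)%E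
  (fun j Y => h2norm_sqr_ge0 _) _ _ _ (fun X j => down_col prec X j)
  (fun Y => assemble Y) Q0).
- exact: assemble_incidence.
- exact: down_col_assemble.
- move=> X iX; rewrite h2norm_sqr_cols; apply: eq_bigr => j _.
  by rewrite submxrowD (mul_submxrow_incidence _ _ iX).
- exact: iQ0.
- exact: h2norm_sqr_fin hQ0.
- exact: iQ.
Qed.
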